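(* Let $(X,d)$ and $(Y,\rho)$ be quasi-metric spaces, where $(X,d)$ has the property that forward parallel implies backward parallel. Let $f:(X,d)\to(Y,\rho)$ be a map. Then the following are equivalent: (a) $f$ is left K-Cauchy regular; (b) the restriction of $f$ to each nonempty hereditarily precompact subset of $X$ is forward uniformly continuous; (c) the restriction of $f$ to each nonempty hereditarily precompact subset of $X$ is left K-Cauchy regular.
   Context: A quasi-metric on a set $X$ is a function $d:X\times X\to\mathbb{R}$ such that for all $x,y,z\in X$: $d(x,y)\ge 0$ and $d(x,x)=0$; $d(x,y)=0=d(y,x)$ implies $x=y$; and $d(x,y)\le d(x,z)+d(z,y)$ (symmetry is not required). Subsets carry the restricted quasi-metric. For sequences in $(X,d)$, $(x_n)$ is forward parallel to $(y_n)$ if $d(x_n,y_n)\to 0$, and backward parallel to $(y_n)$ if $d(y_n,x_n)\to 0$. The property ''forward parallel implies backward parallel'' means: for all sequences $(x_n),(y_n)$ in $X$, if $(x_n)$ is forward parallel to $(y_n)$ then $(x_n)$ is backward parallel to $(y_n)$. A sequence $(x_n)$ is left K-Cauchy if for every $\epsilon>0$ there is $n_0\in\mathbb{N}$ such that $d(x_k,x_n)<\epsilon$ whenever $n_0\le k\le n$. A map between quasi-metric spaces is left K-Cauchy regular if it maps left K-Cauchy sequences to left K-Cauchy sequences. A map $f:(X,d)\to(Y,\rho)$ is forward uniformly continuous if for every $\epsilon>0$ there is $\delta>0$ such that $\rho(f(x),f(y))<\epsilon$ whenever $d(x,y)<\delta$. Put $B^+(x,\epsilon)=\{y\in X:d(x,y)<\epsilon\}$.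 A subset $S$ of $X$ is precompact if for every $\epsilon>0$ there is a finite $Z\subseteq S$ with $S\subseteq\bigcup_{z\in Z}B^+(z,\epsilon)$; it is hereditarily precompact if every subset of $S$ is precompact. *)

(* Defs.v *)
From mathcomp Require Import all_boot all_order all_algebra.
From mathcomp Require Import all_classical all_reals all_analysis.

Set Implicit Arguments.
Unset Strict Implicit.
Unset Printing Implicit Defensive.

Import Order.TTheory GRing.Theory Num.Theory.
Import numFieldNormedType.Exports.

Local Open Scope classical_set_scope.
Local Open Scope ring_scope.

Record quasi_metric (R : realType) (X : Type) := QuasiMetric {
  qdist :> X -> X -> R;
  qdist_ge0 : forall x y, 0 <= qdist x y;
  qdistxx : forall x, qdist x x = 0;
  qdist0_eq : forall x y, qdist x y = 0 -> qdist y x = 0 -> x = y;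
  qdist_triangle : forall x y z, qdist x y <= qdist x z + qdist z y }.

(* [A] is used as a type: the subtype [set_type A] of its elements. *)
Program Definition qrestrict (R : realType) (X : Type) (d : quasi_metric R X)
    (A : set X) : quasi_metric R A :=
  @QuasiMetric R A (fun x y => d (set_val x) (set_val y)) _ _ _ _.
Next Obligation. by move=> *; exact: qdist_ge0. Qed.
Next Obligation. by move=> *; exact: qdistxx. Qed.
Next Obligation.
by move=> R X d A x y dxy dyx; apply: val_inj; exact: qdist0_eq dxy dyx.
Qed.
Next Obligation. by move=> *; exact: qdist_triangle. Qed.

Section Notions.
Context (R : realType) (X : Type) (d : quasi_metric R X).

Definition forward_parallel (x y : nat -> X) : Prop :=
  d (x n) (y n) @[n --> \oo] --> (0 : R).

Definition backward_parallel (x y : nat -> X) : Prop :=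
  d (y n) (x n) @[n --> \oo] --> (0 : R).

Definition forward_parallel_implies_backward : Prop :=
  forall x y : nat -> X, forward_parallel x y -> backward_parallel x y.

Definition left_K_Cauchy (x : nat -> X) : Prop :=
  forall e : R, 0 < e -> exists n0 : nat,
    forall k n : nat, (n0 <= k)%N -> (k <= n)%N -> d (x k) (x n) < e.

Definition forward_ball (x : X) (e : R) : set X := [set y | d x y < e].

Definition precompact_set (S : set X) : Prop :=
  forall e : R, 0 < e -> exists Z : set X,
    [/\ finite_set Z, Z `<=` S & S `<=` \bigcup_(z in Z) forward_ball z e].

Definition hereditarily_precompact (S : set X) : Prop :=
  forall T : set X, T `<=` S -> precompact_set T.

End Notions.

Section Maps.
Context (R : realType) (X Y : Type).
Context (d : quasi_metric R X) (rho : quasi_metric R Y).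

Definition left_K_Cauchy_regular (f : X -> Y) : Prop :=
  forall x : nat -> X, left_K_Cauchy d x -> left_K_Cauchy rho (f \o x).

Definition forward_uniformly_continuous (f : X -> Y) : Prop :=
  forall e : R, 0 < e -> exists2 delta : R, 0 < delta &
    forall x y : X, d x y < delta -> rho (f x) (f y) < e.

End Maps.

(* Main.v *)
Require Import Defs.
From mathcomp Require Import all_boot all_order all_algebra.
From mathcomp Require Import all_classical all_reals all_analysis.
From mathcomp Require Import finmap lra.

(**
  The range of a left K-Cauchy sequence is hereditarily precompact, which gives
  (c) => (a), and forward uniformly continuous maps preserve left K-Cauchy
  sequences, which gives (b) => (c).  For (a) => (b), suppose that uniform
  continuity fails on a precompact set A: there are x_n, y_n in A with
  d(x_n, y_n) < 1/(n+1) and rho(f x_n, f y_n) >= e.  Since forward parallel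
  implies backward parallel, d(x, y) is small uniformly as soon as d(y, x) is,
  so A is covered by finitely many sets of small diameter; along a nonprincipal
  ultrafilter one finds indices n_j -> oo such that (x_(n_j)) is Cauchy in both
  directions.  Then x_(n_0), y_(n_0), x_(n_1), y_(n_1), ... is left K-Cauchy,
  and its image under f is not.
*)

Import Order.TTheory GRing.Theory Num.Theory.
Import numFieldNormedType.Exports.

Local Open Scope classical_set_scope.
Local Open Scope ring_scope.

(** If no [B z] belonged to [U], every complement would, and so would their finite intersection,
    which is disjoint from the union. *)
Lemma ultra_bigcup (T I : Type) (U : set_system T) (Z : set I)
    (B : I -> set T) : UltraFilter U -> finite_set Z ->
  U (\bigcup_(z in Z) B z) -> exists2 z, Z z & U (B z).
Proof.
(* This equips [I] with a choice structure, so that [Z] can be turned into a finite set [D] of the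
   library. *)
elim/Pchoice: I => I in Z B * => UU /finite_fsetP[D ->] UB.
apply: contrapT => noz.
have UC : U (\bigcap_(z in [set` D]) ~` B z).
  apply: filter_bigI => z zD.
  by have [UBz|//] := in_ultra_setVsetC (B z) UU; exfalso; apply: noz; exists z.
have [t [[z zD Bt] Ct]] := filter_ex (filterI UB UC).
exact: (Ct z zD).
Qed.

(** The point [t j] is taken in the intersection of [P 0], ..., [P j], which lies in [F] and hence
    is nonempty. *)
Lemma filter_diagonal (T : Type) (F : set_system T) (P : nat -> set T) :
  ProperFilter F -> (forall i, F (P i)) ->
  exists t : nat -> T, forall i j, (i <= j)%N -> P i (t j).
Proof.
move=> FF FP.
suff /choice[t tP] : forall j, exists s, forall i, (i <= j)%N -> P i s.
  by exists t => i j; exact: tP.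
move=> j; have FQ : forall m, F [set s | forall i, (i <= m)%N -> P i s].
  elim=> [|m IH].
    by apply: filterS (FP 0%N) => s Ps i; rewrite leqn0 => /eqP ->.
  apply: filterS (filterI IH (FP m.+1)) => s [Ps PSs] i.
  by rewrite leq_eqVlt => /predU1P[->//|]; rewrite ltnS; exact: Ps.
by have [s] := filter_ex (FQ j); exists s.
Qed.

Section QuasiMetric.
Context (R : realType) (X : Type) (d : quasi_metric R X).

(** Counterexamples for [delta] equal to 1/(n+1) would form two sequences that are forward but not
    backward parallel. *)
Lemma parallel_uniform : forward_parallel_implies_backward d ->
  forall e : R, 0 < e -> exists2 delta : R, 0 < delta &
    forall x y, d x y < delta -> d y x < e.
Proof.
move=> hd e e0; apply: contrapT => nodelta.
have /choice[p pP] : forall n : nat, exists p : X * X,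
    d p.1 p.2 < n.+1%:R^-1 /\ e <= d p.2 p.1.
  move=> n; apply: contrapT => nop; apply: nodelta; exists n.+1%:R^-1 => //.
  move=> x y dxy; rewrite ltNge; apply/negP => dyx.
  by apply: nop; exists (x, y).
have fwd : forward_parallel d (fun n => (p n).1) (fun n => (p n).2).
  apply: (@squeeze_cvgr _ _ _ _ (cst 0) (@harmonic R)).
  - by apply: nearW => n /=; rewrite qdist_ge0 ltW//; case: (pP n).
  - exact: cvg_cst.
  - exact: cvg_harmonic.
have [n _ /(_ n (leqnn n))] := cvgr_lt _ (hd _ _ fwd) _ e0.
by rewrite /= ltNge; have [_ ->] := pP n.
Qed.

Lemma left_K_Cauchy_range (x : nat -> X) :
  left_K_Cauchy d x -> hereditarily_precompact d (range x).
Proof.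
move=> xC T Tx e e0; have [n0 n0P] := xC e e0.
have fin m : finite_set (x @` [set k | (k < m)%N /\ T (x k)]).
  by apply: finite_image; apply: (sub_finite_set _ (finite_II m)) => k [].
have cover m :
    (forall k, T (x k) ->
      exists2 j, (j < m)%N /\ T (x j) & d (x j) (x k) < e) ->
    exists Z : set X,
      [/\ finite_set Z, Z `<=` T & T `<=` \bigcup_(z in Z) forward_ball d z e].
  move=> mP; exists (x @` [set k | (k < m)%N /\ T (x k)]); split => //.
    by move=> _ [k [_ Tk] <-].
  move=> y Ty; have [k _ xky] := Tx y Ty; subst y.
  by have [j jP djk] := mP k Ty; exists (x j) => //; exists j.
(* The centres must lie in [T]. If [T] contains some [x m] with [n0 <= m], the ball around it
   catches all later terms; otherwise [T] has only terms of index below [n0]. *)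
have [[m [n0m Tm]]|nom] := pselect (exists m, (n0 <= m)%N /\ T (x m)).
  apply: (cover m.+1) => k Tk; have [km|mk] := ltnP k m.+1.
    by exists k; rewrite ?qdistxx.
  by exists m => //; apply: n0P => //; exact: ltnW.
apply: (cover n0) => k Tk; exists k; rewrite ?qdistxx//; split => //.
by rewrite ltnNge; apply/negP => n0k; apply: nom; exists k.
Qed.

Lemma precompact_ultra_small (A : set X) (x : nat -> X) (U : set_system nat) :
  forward_parallel_implies_backward d -> precompact_set d A ->
  (forall n, A (x n)) -> UltraFilter U ->
  forall e : R, 0 < e ->
    exists2 S, U S & forall p q, S p -> S q -> d (x p) (x q) < e.
Proof.
move=> hd Apc Ax UU e e0; have e20 : 0 < e / 2 by lra.
have [delta delta0 deltaP] := parallel_uniform hd _ e20.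
(* With this radius a point of the ball around [z] is within [e / 2] of [z] in both directions. *)
have m0 : 0 < Num.min delta (e / 2) by rewrite lt_min delta0.
have [Z [Zfin ZA AZ]] := Apc _ m0.
have [|z Zz Uz] := ultra_bigcup _ _ U Z
    (fun z => [set n | d z (x n) < Num.min delta (e / 2)]) UU Zfin.
  by apply: filterS filterT => n _; exact: AZ (Ax n).
exists [set n | d z (x n) < Num.min delta (e / 2)] => // p q /=.
rewrite !lt_min => /andP[/deltaP dpz _] /andP[_ dzq].
by have := qdist_triangle d (x p) (x q) z; lra.
Qed.

(** The longest path, from one [y] to a later one, runs through the two matching terms of [x]: three
    steps, each below [e / 3], the first by backward parallelism. *)
Lemma interlaced_left_K_Cauchy (x y : nat -> X) :
  forward_parallel_implies_backward d ->
  forward_parallel d x y -> left_K_Cauchy d x ->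
  left_K_Cauchy d (fun m => if odd m then y m./2 else x m./2).
Proof.
move=> hd xy xC e e0; have e30 : 0 < e / 3 by lra.
have [n0 n0P] := xC _ e30.
have [n1 _ n1P] := cvgr_lt _ xy _ e30.
have [n2 _ n2P] := cvgr_lt _ (hd _ _ xy) _ e30.
exists (maxn n0 (maxn n1 n2)).*2 => k n mk kn.
have /[!geq_max] /and3P[k0 k1 k2] : (maxn n0 (maxn n1 n2) <= k./2)%N.
  by rewrite -[leqLHS]doubleK half_leq.
have {}kn : (k./2 <= n./2)%N by rewrite half_leq.
have dx := n0P _ _ k0 kn.
have dxy := n1P _ (leq_trans k1 kn).
have dyx := n2P _ k2.
have t1 := qdist_triangle d (x k./2) (y n./2) (x n./2).
have t2 := qdist_triangle d (y k./2) (x n./2) (x k./2).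
have t3 := qdist_triangle d (y k./2) (y n./2) (x n./2).
rewrite /= in dxy dyx; case: (odd k); case: (odd n); lra.
Qed.

End QuasiMetric.

Section Maps.
Context (R : realType) (X Y : Type).
Context (d : quasi_metric R X) (rho : quasi_metric R Y).

Lemma uniformly_continuous_regular (f : X -> Y) :
  forward_uniformly_continuous d rho f -> left_K_Cauchy_regular d rho f.
Proof.
move=> fuc x xC e e0; have [delta delta0 fP] := fuc e e0.
have [n0 n0P] := xC delta delta0.
by exists n0 => k n n0k kn; apply: fP; exact: n0P.
Qed.

Lemma regular_uniformly_continuous (f : X -> Y) (A : set X) :
  forward_parallel_implies_backward d -> left_K_Cauchy_regular d rho f ->
  precompact_set d A ->
  forward_uniformly_continuous (qrestrict d A) rho (sigL A f).
Proof.
move=> hd freg Apc e e0; apply: contrapT => nodelta.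
have /choice[p pP] : forall n : nat, exists p : A * A,
    d (val p.1) (val p.2) < n.+1%:R^-1 /\
    e <= rho (f (val p.1)) (f (val p.2)).
  move=> n; apply: contrapT => nop; apply: nodelta; exists n.+1%:R^-1 => //.
  move=> x y dxy; rewrite ltNge; apply/negP => fxy.
  by apply: nop; exists (x, y).
pose x n := val (p n).1; pose y n := val (p n).2.
have [U [UU Uoo]] := ultraFilterLemma (F := \oo) _.
have xA n : A (x n) by exact/set_mem/valP.
have /choice[S SP] : forall i : nat, exists S, U S /\
    forall a b, S a -> S b -> d (x a) (x b) < i.+1%:R^-1.
  move=> i; have i0 : (0 : R) < i.+1%:R^-1 by [].
  have [S US SP] :=
    precompact_ultra_small _ _ d A x U hd Apc xA UU _ i0.
  by exists S.
(* Intersecting with tails gives [j <= n j], so the distance from [x (n j)] to [y (n j)] is below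
   1/(j+1). *)
have [|n nP] := filter_diagonal _ U (fun i => S i `&` [set k | (i <= k)%N]) _.
  by move=> i; apply: filterI; [case: (SP i)|apply: Uoo; exists i].
have xC : left_K_Cauchy d (x \o n).
  move=> r r0; have [i] := ltr_add_invr r0; rewrite add0r => ir.
  exists i => k m ik km; apply: lt_trans ir; apply: (SP i).2.
    by case: (nP i k ik).
  by case: (nP i m (leq_trans ik km)).
have xy : forward_parallel d (x \o n) (y \o n).
  apply: (@squeeze_cvgr _ _ _ _ (cst 0) (@harmonic R)).
  - apply: nearW => i /=; rewrite qdist_ge0 ltW//.
    have [_ /= ini] := nP i i (leqnn i).
    apply: lt_le_trans (pP (n i)).1 _.
    by rewrite lef_pV2 ?posrE ?ltr0Sn// ler_nat.
  - exact: cvg_cst.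
  - exact: cvg_harmonic.
have [n0 n0P] := freg _ (interlaced_left_K_Cauchy _ _ _ _ _ hd xy xC) e e0.
(* These two consecutive indices carry [x (n n0)] and [y (n n0)], whose images are at distance at
   least [e]. *)
have := n0P n0.*2 n0.*2.+1; rewrite /= odd_double /= uphalf_double doubleK.
rewrite -addnn leq_addr => /(_ isT (leqnSn _)).
by rewrite ltNge (pP (n n0)).2.
Qed.

End Maps.

Theorem theorem5p2 (R : realType) (X Y : Type)
    (d : quasi_metric R X) (rho : quasi_metric R Y)
    (hd : forward_parallel_implies_backward d) (f : X -> Y) :
  [<-> left_K_Cauchy_regular d rho f;
       forall A : set X, A !=set0 -> hereditarily_precompact d A ->
         forward_uniformly_continuous (qrestrict d A) rho (sigL A f);
       forall A : set X, A !=set0 -> hereditarily_precompact d A ->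
         left_K_Cauchy_regular (qrestrict d A) rho (sigL A f)].
Proof.
tfae.
- move=> freg A _ Ahpc; apply: regular_uniformly_continuous => //.
  exact: Ahpc.
- by move=> fuc A A0 Ahpc; apply: uniformly_continuous_regular; exact: fuc.
(* Here [z] is [x] viewed in its own range; both Cauchy conditions on it unfold to those on [x] and
   [f \o x]. *)
- move=> fA x xC; pose z n : range x := SigSub (mem_set (imageT x n)).
  have x0 : range x !=set0 by exists (x 0%N); exact: imageT.
  exact: (fA _ x0 (left_K_Cauchy_range _ _ d x xC) z xC).
Qed.
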